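(* Let $X\in\mathcal{X}(\mathbb{R}^2,\mu)$, where $\mu=(1+x)\,dy$. Then: (i) $X$ does not possess hyperbolic singularities. (ii) If $X(0)\neq 0$, then there is a constant $a\in\mathbb{R}$, $a\neq 0$, such that $X$ is $\mu$-conjugate to either $X_0=a\frac{\partial}{\partial y}$ or to $X_1=-a(1+x)\frac{\partial}{\partial x}+ay\frac{\partial}{\partial y}$. (iii) If $k\geq 2$ is an integer such that $j^iX(0)=0$ for $i=0,\dots,k-2$ and $j^{k-1}X(0)\neq 0$, then there are constants $a,d\in\mathbb{R}$, $a\neq 0$, such that $X$ is $\mu$-conjugate to $$X_k=-(1+x)\left(a k y^{k-1}+d(2k-1)y^{2k-2}\right)\frac{\partial}{\partial x}+\left(a y^k+d y^{2k-1}\right)\frac{\partial}{\partial y}.$$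
   Context: Everything is $C^\infty$ and local: objects are germs at the origin, and the neighbourhoods of the origin considered do not meet the line $x=-1$. Let $\mu=(1+x)\,dy$ on $\mathbb{R}^2$ with coordinates $(x,y)$. $\mathcal{X}(\mathbb{R}^2,\mu)$ is the set of germs at the origin of smooth vector fields $X$ on $\mathbb{R}^2$ with $\mathcal{L}_X\mu=0$ ($\mathcal{L}_X$ is the Lie derivative). $Diff(\mathbb{R}^2,\mu)$ is the set of germs at the origin of smooth diffeomorphisms $\phi$ of $\mathbb{R}^2$ with $\phi(0,0)=(0,0)$ and $\phi^*\mu=\mu$. Two fields $X,Y\in\mathcal{X}(\mathbb{R}^2,\mu)$ are called $\mu$-conjugate if there is $\phi\in Diff(\mathbb{R}^2,\mu)$ with $\phi_*Y=X$, i.e. $D\phi\cdot Y=X\circ\phi$. $j^iX(0)$ denotes the $i$-jet of $X$ at the origin. A singularity is a zero of the vector field; it is hyperbolic if no eigenvalue of the linearization there has zero real part. *)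

(* Defs.v *)
From Stdlib Require Import Reals.
From Coquelicot Require Import Coquelicot.
Open Scope R_scope.

(* Maps, vector fields and 1-forms in the coordinates (x, y).  A vector field
   p |-> (P p, Q p) stands for P d/dx + Q d/dy, a 1-form p |-> (A p, B p) for
   A dx + B dy.  Germs at the origin are represented by total functions, of
   which only the values near the origin are constrained. *)
Definition plane_map := R * R -> R * R.
Definition vector_field := R * R -> R * R.
Definition one_form := R * R -> R * R.

Definition origin : R * R := (0, 0).

Definition comp1 (F : R * R -> R * R) : R -> R -> R := fun x y => fst (F (x, y)).
Definition comp2 (F : R * R -> R * R) : R -> R -> R := fun x y => snd (F (x, y)).

Definition pdx (f : R -> R -> R) (p : R * R) : R :=
  Derive (fun t => f t (snd p)) (fst p).
Definition pdy (f : R -> R -> R) (p : R * R) : R :=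
  Derive (fun t => f (fst p) t) (snd p).

Definition nbhd (U : R * R -> Prop) : Prop :=
  open U /\ U origin /\ forall p, U p -> fst p <> -1.

(* [ex_diff_n f n x y] holds when f and all its iterated partial derivatives up
   to order n exist and are continuous at (x, y); on an open set this is C^n. *)
Definition smooth_on (U : R * R -> Prop) (F : R * R -> R * R) : Prop :=
  forall p, U p -> forall n : nat,
    ex_diff_n (comp1 F) n (fst p) (snd p) /\
    ex_diff_n (comp2 F) n (fst p) (snd p).

Definition tangent_map (phi : plane_map) (p v : R * R) : R * R :=
  (pdx (comp1 phi) p * fst v + pdy (comp1 phi) p * snd v,
   pdx (comp2 phi) p * fst v + pdy (comp2 phi) p * snd v).

Definition pullback (phi : plane_map) (al : one_form) : one_form :=
  fun p =>
    (fst (al (phi p)) * pdx (comp1 phi) p + snd (al (phi p)) * pdx (comp2 phi) p,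
     fst (al (phi p)) * pdy (comp1 phi) p + snd (al (phi p)) * pdy (comp2 phi) p).

(* (L_X al)_i = sum_j (X^j d_j al_i + al_j d_i X^j). *)
Definition Lie_derivative (X : vector_field) (al : one_form) : one_form :=
  fun p =>
    ((fst (X p) * pdx (comp1 al) p + snd (X p) * pdy (comp1 al) p)
       + (fst (al p) * pdx (comp1 X) p + snd (al p) * pdx (comp2 X) p),
     (fst (X p) * pdx (comp2 al) p + snd (X p) * pdy (comp2 al) p)
       + (fst (al p) * pdy (comp1 X) p + snd (al p) * pdy (comp2 X) p)).

Definition mu : one_form := fun p => (0, 1 + fst p).

Definition preserving_on (U : R * R -> Prop) (al : one_form) (X : vector_field)
  : Prop :=
  smooth_on U X /\ forall p, U p -> Lie_derivative X al p = (0, 0).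

Definition in_fields (al : one_form) (X : vector_field) : Prop :=
  exists U, nbhd U /\ preserving_on U al X.

Definition in_Diff (al : one_form) (phi : plane_map) : Prop :=
  phi origin = origin /\
  exists (U V : R * R -> Prop) (psi : plane_map),
    nbhd U /\ nbhd V /\ smooth_on U phi /\ smooth_on V psi /\
    (forall p, U p -> V (phi p) /\ psi (phi p) = p) /\
    (forall q, V q -> U (psi q) /\ phi (psi q) = q) /\
    (forall p, U p -> pullback phi al p = al p).

Definition conjugate (al : one_form) (X Y : vector_field) : Prop :=
  in_fields al X /\ in_fields al Y /\
  exists phi : plane_map, in_Diff al phi /\
    locally origin (fun p => tangent_map phi p (Y p) = X (phi p)).

Definition linearization_eigenvalue (X : vector_field) (p : R * R) (lambda : C)
  : Prop :=
  exists v w : C, (v, w) <> (RtoC 0, RtoC 0) /\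
    (RtoC (pdx (comp1 X) p) * v + RtoC (pdy (comp1 X) p) * w = lambda * v)%C /\
    (RtoC (pdx (comp2 X) p) * v + RtoC (pdy (comp2 X) p) * w = lambda * w)%C.

Definition singularity (X : vector_field) (p : R * R) : Prop := X p = (0, 0).

Definition hyperbolic_singularity (X : vector_field) (p : R * R) : Prop :=
  singularity X p /\
  forall lambda : C, linearization_eigenvalue X p lambda -> Re lambda <> 0.

Definition same_jet (i : nat) (X Y : vector_field) : Prop :=
  forall m n : nat, (m + n <= i)%nat ->
    partial_derive m n (comp1 X) 0 0 = partial_derive m n (comp1 Y) 0 0 /\
    partial_derive m n (comp2 X) 0 0 = partial_derive m n (comp2 Y) 0 0.

Definition zero_field : vector_field := fun _ => (0, 0).

Definition normal_form_0 (a : R) : vector_field := fun _ => (0, a).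

Definition normal_form_1 (a : R) : vector_field :=
  fun p => (- a * (1 + fst p), a * snd p).

Definition normal_form (k : nat) (a d : R) : vector_field :=
  fun p => let (x, y) := p in
    (- (1 + x) * (a * INR k * y ^ (k - 1)
                  + d * (2 * INR k - 1) * y ^ (2 * k - 2)),
     a * y ^ k + d * y ^ (2 * k - 1)).

(* Main.v *)
Require Import Defs.
From Stdlib Require Import Reals Lra Lia Arith ClassicalEpsilon Ranalysis5.
From Coquelicot Require Import Coquelicot.
Open Scope R_scope.

(** Write X = P d/dx + Q d/dy.  Away from the line x = -1, the equation
    L_X mu = 0 says that Q_x = 0 and P = - (1 + x) Q_y, so near the origin
    X (x, y) = (- (1 + x) f' y, f y) for a smooth function f of one variable:
    X is the lift of the field f d/dy of the line
    ([preserving_mu_line_lift]).  The second row of the linearization at a singularity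
    is then zero, so 0 is an eigenvalue there, which is (i).

    In the same way a map that preserves mu has the form
    (x, y) |-> ((1 + x) / g' y - 1, g y), and it carries the lift of h to the
    lift of f as soon as g carries h d/dy to f d/dy.  Fixing the origin forces
    g 0 = 0 and g' 0 = 1.  Everything thus reduces to the classification of
    fields on the line under maps tangent to the identity
    ([line_lift_conjugate]), where the inverse F of g has to solve
    F' f = h (F).

    Let f y = y ^ k u y with u 0 = a <> 0.  Solving F' f = h (F) amounts to
    matching the primitives of dy / f y and dz / h z.
    - For k = 0 and h = a the equation is F' = a / f.
    - The singular primitive of dy / f y has the form
      y ^ (- p) al y + c log |y| with p = k - 1 and al smooth
      ([euler_equation]), c being the residue.  For k = 1 and h z = a z, this
      gives F y = y exp (a (al y - al 0)).
    - For k >= 2 and h z = a z ^ k + d z ^ (2 k - 1), the residue of dz / h z is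
      - d / a ^ 2, so d := - c a ^ 2 makes the logarithms of y cancel when one
      puts F y = y m y.  With q y = c a y ^ p and m y ^ (- p) = exp v + q y, what
      remains is exp v + q y v = ga y, where ga is a given smooth function with
      ga 0 = 1.  Since q 0 = 0, the implicit function theorem gives a smooth
      solution v with v 0 = 0 ([line_conjugate_power]).

    The order k is read off the jets of X: the components of the k-jet of a lift
    vanish exactly when the derivatives of f up to order k + 1 do
    ([line_lift_jets]). *)

(** * Smooth functions of one variable *)

(** Continuity of the last derivative is left out: it is automatic once all
    orders are required, and the inductions get a trivial base case. *)
Fixpoint diff_n (I : R -> Prop) (n : nat) (f : R -> R) : Prop :=
  match n with
  | 0%nat => True
  | S n => (forall x, I x -> ex_derive f x) /\ diff_n I n (Derive f)
  end.

Definition smooth (I : R -> Prop) (f : R -> R) : Prop := forall n, diff_n I n f.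

Lemma smooth_ex_derive I f x : smooth I f -> I x -> ex_derive f x.
Proof. intros H; apply (proj1 (H 1%nat)). Qed.

Lemma smooth_is_derive I f x : smooth I f -> I x -> is_derive f x (Derive f x).
Proof. intros H Hx; apply Derive_correct, (smooth_ex_derive _ _ _ H Hx). Qed.

Lemma smooth_continuous I f x : smooth I f -> I x -> continuous f x.
Proof.
  intros H Hx; apply (ex_derive_continuous f), (smooth_ex_derive _ _ _ H Hx).
Qed.

Lemma smooth_Derive I f : smooth I f -> smooth I (Derive f).
Proof. intros H n; apply (H (S n)). Qed.

Lemma diff_n_pred I n f : diff_n I (S n) f -> diff_n I n f.
Proof.
  revert f; induction n as [|n IH]; intros f [H1 H2]; [exact Logic.I|].
  split; [exact H1 | apply IH, H2].
Qed.

Lemma diff_n_incl (I J : R -> Prop) n f :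
  (forall x, J x -> I x) -> diff_n I n f -> diff_n J n f.
Proof.
  intros HJ; revert f; induction n as [|n IH]; intros f; [trivial|].
  intros [H1 H2]; split; [auto | apply IH, H2].
Qed.

Lemma smooth_incl (I J : R -> Prop) f :
  (forall x, J x -> I x) -> smooth I f -> smooth J f.
Proof. intros HJ H n; apply (diff_n_incl I), H; exact HJ. Qed.

Section Closure.

Variable I : R -> Prop.
Hypothesis HI : open I.

Lemma diff_n_ext n f g :
  (forall x, I x -> f x = g x) -> diff_n I n f -> diff_n I n g.
Proof.
  revert f g; induction n as [|n IH]; intros f g E; [trivial|].
  intros [H1 H2].
  assert (L : forall x, I x -> locally x (fun t => f t = g t)).
  { intros x Hx; apply filter_imp with (2 := HI x Hx); exact E. }
  split.
  - intros x Hx; apply (ex_derive_ext_loc f); auto.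
  - apply (IH (Derive f)); [|exact H2].
    intros x Hx; apply Derive_ext_loc, L, Hx.
Qed.

Lemma smooth_ext f g : (forall x, I x -> f x = g x) -> smooth I f -> smooth I g.
Proof. intros E H n; apply (diff_n_ext n f), H; exact E. Qed.

(** Every closure property below is an induction on the order, whose step reads
    the derivative off the differentiation rule. *)
Lemma diff_n_S n f df :
  (forall x, I x -> is_derive f x (df x)) -> diff_n I n df -> diff_n I (S n) f.
Proof.
  intros H1 H2; split.
  - intros x Hx; exists (df x); auto.
  - apply (diff_n_ext n df); [|exact H2].
    intros x Hx; symmetry; apply is_derive_unique; auto.
Qed.

Lemma smooth_of_is_derive f df :
  (forall x, I x -> is_derive f x (df x)) -> smooth I df -> smooth I f.
Proof. intros H1 H2 [|n]; [exact Logic.I | exact (diff_n_S n f df H1 (H2 n))]. Qed.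

Lemma smooth_const c : smooth I (fun _ => c).
Proof.
  intros n; revert c; induction n as [|n IH]; intros c; [exact Logic.I|].
  apply (diff_n_S n _ (fun _ => 0)); [|apply IH].
  intros x _; apply (is_derive_const c).
Qed.

Lemma smooth_id : smooth I (fun x => x).
Proof.
  apply (smooth_of_is_derive _ (fun _ => 1)); [|apply smooth_const].
  intros x _; apply (is_derive_id x).
Qed.

Lemma diff_n_plus n f g :
  diff_n I n f -> diff_n I n g -> diff_n I n (fun x => f x + g x).
Proof.
  revert f g; induction n as [|n IH]; intros f g; [trivial|].
  intros [F1 F2] [G1 G2].
  apply (diff_n_S n _ (fun x => Derive f x + Derive g x)); [|apply IH; auto].
  intros x Hx; apply (is_derive_plus f g); apply Derive_correct; auto.
Qed.

Lemma diff_n_mult n f g :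
  diff_n I n f -> diff_n I n g -> diff_n I n (fun x => f x * g x).
Proof.
  revert f g; induction n as [|n IH]; intros f g; [trivial|].
  intros F G; pose proof F as [F1 F2]; pose proof G as [G1 G2].
  apply (diff_n_S n _ (fun x => Derive f x * g x + f x * Derive g x)).
  - intros x Hx; auto_derive; [auto|].
    change (fun t => f t) with f; change (fun t => g t) with g; ring.
  - apply diff_n_plus; apply IH; auto using diff_n_pred.
Qed.

Lemma smooth_plus f g : smooth I f -> smooth I g -> smooth I (fun x => f x + g x).
Proof. intros F G n; apply diff_n_plus; auto. Qed.

Lemma smooth_mult f g : smooth I f -> smooth I g -> smooth I (fun x => f x * g x).
Proof. intros F G n; apply diff_n_mult; auto. Qed.

Lemma smooth_opp f : smooth I f -> smooth I (fun x => - f x).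
Proof.
  intros F; apply (smooth_ext (fun x => (-1) * f x)); [intros; ring|].
  apply smooth_mult; [apply smooth_const | exact F].
Qed.

Lemma smooth_minus f g : smooth I f -> smooth I g -> smooth I (fun x => f x - g x).
Proof. intros F G; apply smooth_plus; [exact F | apply smooth_opp, G]. Qed.

Lemma smooth_pow f k : smooth I f -> smooth I (fun x => f x ^ k).
Proof.
  intros F; induction k as [|k IH]; simpl; [apply smooth_const|].
  apply smooth_mult; assumption.
Qed.

Lemma diff_n_comp (J : R -> Prop) n f g :
  (forall x, I x -> J (g x)) ->
  diff_n J n f -> diff_n I n g -> diff_n I n (fun x => f (g x)).
Proof.
  intros IJ; revert f g IJ; induction n as [|n IH]; intros f g IJ; [trivial|].
  intros F G; pose proof F as [F1 F2]; pose proof G as [G1 G2].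
  apply (diff_n_S n _ (fun x => Derive g x * Derive f (g x))).
  - intros x Hx; apply (is_derive_comp f g); apply Derive_correct; auto.
  - apply diff_n_mult; [exact G2 | apply IH; auto using diff_n_pred].
Qed.

Lemma smooth_comp (J : R -> Prop) f g :
  (forall x, I x -> J (g x)) ->
  smooth J f -> smooth I g -> smooth I (fun x => f (g x)).
Proof. intros IJ F G n; apply (diff_n_comp J); auto. Qed.

Lemma smooth_exp : smooth I exp.
Proof.
  intros n; induction n as [|n IH]; [exact Logic.I|].
  apply (diff_n_S n _ exp); [|exact IH].
  intros x _; apply is_derive_exp.
Qed.

Lemma diff_n_inv n f :
  (forall x, I x -> f x <> 0) -> diff_n I n f -> diff_n I n (fun x => / f x).
Proof.
  intros Z; induction n as [|n IH]; [trivial|].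
  intros F; pose proof F as [F1 F2].
  assert (V : diff_n I n (fun x => / f x)) by (apply IH, diff_n_pred, F).
  apply (diff_n_S n _ (fun x => Derive f x * ((- 1) * (/ f x * / f x)))).
  - intros x Hx; auto_derive; [auto|].
    change (fun t => f t) with f; field; auto.
  - repeat apply diff_n_mult; auto; apply smooth_const.
Qed.

Lemma smooth_inv f :
  (forall x, I x -> f x <> 0) -> smooth I f -> smooth I (fun x => / f x).
Proof. intros Z F n; apply diff_n_inv; auto. Qed.

Lemma smooth_ln f :
  (forall x, I x -> 0 < f x) -> smooth I f -> smooth I (fun x => ln (f x)).
Proof.
  intros Z F; apply (smooth_of_is_derive _ (fun x => Derive f x * / f x)).
  - intros x Hx; auto_derive; [|change (fun t => f t) with f; ring].
    split; [apply (smooth_ex_derive I); auto | auto].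
  - apply smooth_mult; [apply smooth_Derive, F|].
    apply smooth_inv; [intros x Hx; specialize (Z x Hx); lra | exact F].
Qed.

End Closure.

(** * Division by the variable *)

Definition itv (r : R) : R -> Prop := fun x => - r < x < r.

Lemma itv_open r : open (itv r).
Proof. apply open_and; [apply open_gt | apply open_lt]. Qed.

Lemma itv_0 r : 0 < r -> itv r 0.
Proof. unfold itv; lra. Qed.

Lemma locally_itv r (P : R -> Prop) :
  0 < r -> locally 0 P -> exists s, 0 < s <= r /\ forall y, itv s y -> P y.
Proof.
  intros Hr [d Hd]; exists (Rmin r d); split.
  - split; [apply Rmin_glb_lt; [lra | apply (cond_pos d)] | apply Rmin_l].
  - intros y Hy; apply Hd; change (Rabs (y - 0) < d).
    pose proof (Rmin_r r d); unfold itv in Hy; apply Rabs_def1; lra.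
Qed.

Lemma itv_incl r s y : s <= r -> itv s y -> itv r y.
Proof. unfold itv; lra. Qed.

Lemma itv_scale r x t : itv r x -> 0 <= t <= 1 -> itv r (x * t).
Proof. unfold itv; intros; split; nra. Qed.

Lemma continuity_2d_pt_pow (j : nat) x y :
  continuity_2d_pt (fun _ v => v ^ j) x y.
Proof.
  apply (continuity_1d_2d_pt_comp (fun v => v ^ j) (fun _ v => v)).
  - apply derivable_continuous_pt, derivable_pt_pow.
  - apply continuity_2d_pt_id2.
Qed.

(** The weight [t ^ j] makes the family of these means closed under
    differentiation, whence their smoothness by induction. *)
Lemma is_derive_weighted_mean r f j y :
  smooth (itv r) f -> itv r y ->
  is_derive (fun x => RInt (fun t => t ^ j * f (x * t)) 0 1) y
            (RInt (fun t => t ^ S j * Derive f (y * t)) 0 1).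
Proof.
  intros F Hy.
  assert (B : forall t, Rmin 0 1 <= t <= Rmax 0 1 -> 0 <= t <= 1).
  { intros t; rewrite Rmin_left, Rmax_right by lra; auto. }
  assert (D : forall x t, itv r (x * t) ->
    is_derive (fun u => t ^ j * f (u * t)) x (t ^ S j * Derive f (x * t))).
  { intros x t Hx; auto_derive.
    - apply (smooth_ex_derive (itv r)); auto.
    - change (fun t => f t) with f; simpl; ring. }
  rewrite (RInt_ext _ (fun t => Derive (fun u => t ^ j * f (u * t)) y)).
  2: { intros t Ht; symmetry; apply is_derive_unique, D, itv_scale; [exact Hy|].
       apply B; lra. }
  apply (is_derive_RInt_param (fun x t => t ^ j * f (x * t))).
  - apply filter_imp with (2 := itv_open r y Hy).
    intros x Hx t Ht; exists (t ^ S j * Derive f (x * t)).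
    apply D, itv_scale; auto.
  - intros t Ht.
    assert (Hyt : itv r (y * t)) by (apply itv_scale; auto).
    assert (C : continuity_2d_pt (fun u v => u * v) y t).
    { apply continuity_2d_pt_mult; [apply continuity_2d_pt_id1
                                   | apply continuity_2d_pt_id2]. }
    apply (continuity_2d_pt_ext_loc (fun u v => v ^ S j * Derive f (u * v))).
    + destruct (itv_open r _ Hyt) as [eps He].
      apply locally_2d_impl with (2 := C eps).
      apply locally_2d_forall; intros u v Huv.
      symmetry; apply is_derive_unique, D, He, Huv.
    + apply continuity_2d_pt_mult; [apply continuity_2d_pt_pow|].
      apply (continuity_1d_2d_pt_comp (Derive f) (fun u v => u * v)); [|exact C].
      apply continuity_pt_filterlim.
      apply (smooth_continuous (itv r)); [apply smooth_Derive, F | exact Hyt].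
  - apply filter_imp with (2 := itv_open r y Hy).
    intros x Hx; apply (ex_RInt_continuous (V := R_CompleteNormedModule)); intros t Ht.
    apply (ex_derive_continuous (fun t => t ^ j * f (x * t))).
    auto_derive.
    apply (smooth_ex_derive (itv r)); [exact F | apply itv_scale; auto].
Qed.

Lemma smooth_weighted_mean r f j :
  smooth (itv r) f ->
  smooth (itv r) (fun x => RInt (fun t => t ^ j * f (x * t)) 0 1).
Proof.
  intros F n; revert f j F; induction n as [|n IH]; intros f j F; [exact I|].
  apply (diff_n_S _ (itv_open r) n _
           (fun x => RInt (fun t => t ^ S j * Derive f (x * t)) 0 1)).
  - intros x Hx; apply (is_derive_weighted_mean r); assumption.
  - apply IH, smooth_Derive, F.
Qed.

(** Hadamard: [f y - f 0] is [y] times the mean of [Derive f] on the segment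
    from 0 to [y], and that mean is smooth, by differentiation under the
    integral sign. *)
Lemma smooth_divide r f :
  smooth (itv r) f ->
  exists g, smooth (itv r) g /\ forall y, itv r y -> f y = f 0 + y * g y.
Proof.
  intros F.
  exists (fun x => RInt (fun t => t ^ 0 * Derive f (x * t)) 0 1); split.
  { apply smooth_weighted_mean, smooth_Derive, F. }
  intros y Hy.
  assert (B : forall t, Rmin 0 1 <= t <= Rmax 0 1 -> itv r (y * t)).
  { intros t; rewrite Rmin_left, Rmax_right by lra; intros; apply itv_scale; auto. }
  assert (H : is_RInt (fun t => y * Derive f (y * t)) 0 1
                      (minus (f (y * 1)) (f (y * 0)))).
  { apply (is_RInt_derive (fun t => f (y * t))); intros t Ht.
    - auto_derive; [apply (smooth_ex_derive (itv r)); auto|].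
      change (fun t => f t) with f; ring.
    - apply (ex_derive_continuous (fun t => y * Derive f (y * t))).
      auto_derive; apply (smooth_ex_derive (itv r)); auto using smooth_Derive. }
  apply (is_RInt_unique (V := R_CompleteNormedModule)) in H.
  rewrite Rmult_1_r, Rmult_0_r in H.
  change (minus (f y) (f 0)) with (f y - f 0) in H.
  enough (y * RInt (fun t => t ^ 0 * Derive f (y * t)) 0 1 = f y - f 0) by lra.
  rewrite <- H.
  rewrite (RInt_ext (fun t => t ^ 0 * Derive f (y * t)) (fun t => Derive f (y * t)))
    by (intros; simpl; ring).
  symmetry; apply (RInt_scal (fun t => Derive f (y * t)) 0 1 y).
  apply (ex_RInt_continuous (V := R_CompleteNormedModule)); intros t Ht.
  apply (ex_derive_continuous (fun t => Derive f (y * t))).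
  auto_derive; apply (smooth_ex_derive (itv r)); auto using smooth_Derive.
Qed.

(** * Singular primitives *)

Lemma smooth_antiderivative r f :
  smooth (itv r) f ->
  exists F, F 0 = 0 /\ smooth (itv r) F /\ forall x, itv r x -> is_derive F x (f x).
Proof.
  intros H; exists (fun x => RInt f 0 x).
  assert (D : forall x, itv r x -> is_derive (fun x => RInt f 0 x) x (f x)).
  { intros x Hx; apply (is_derive_RInt f _ 0).
    - apply filter_imp with (2 := itv_open r x Hx); intros z Hz.
      apply (RInt_correct (V := R_CompleteNormedModule)).
      apply (ex_RInt_continuous (V := R_CompleteNormedModule)); intros t Ht.
      apply (smooth_continuous (itv r)); [exact H|].
      revert Ht; unfold itv in *; unfold Rmin, Rmax; destruct Rle_dec; lra.
    - apply (smooth_continuous (itv r)); assumption. }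
  split; [exact (RInt_point 0 f)|]; split; [|exact D].
  exact (smooth_of_is_derive _ (itv_open r) _ f D H).
Qed.

(** The equation says that [y ^ (- p) * al y] is a primitive of
    [y ^ (- p - 1) * w y - c / y], so [c] has to be the coefficient of [y ^ p] in
    [w], the only monomial that [y * d/dy - p] misses.  The solution for [p + 1]
    is obtained from the one for [p] by splitting [w y = w 0 + y * w1 y]. *)
Lemma euler_equation r p w :
  smooth (itv r) w ->
  exists c al, smooth (itv r) al /\
    forall y, itv r y -> y * Derive al y - INR p * al y = w y - c * y ^ p.
Proof.
  revert w; induction p as [|p IH]; intros w W;
    destruct (smooth_divide r w W) as [w1 [W1 E]].
  - destruct (smooth_antiderivative r w1 W1) as [al [_ [Hal D]]].
    exists (w 0), al; split; [exact Hal|].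
    intros y Hy; rewrite (is_derive_unique _ _ _ (D y Hy)), (E y Hy); simpl; ring.
  - destruct (IH w1 W1) as [c [al [Hal D]]].
    assert (Hp : INR (S p) <> 0) by (apply not_0_INR; lia).
    exists c, (fun y => - w 0 / INR (S p) + y * al y); split.
    { apply smooth_plus; [apply itv_open | apply smooth_const, itv_open|].
      apply smooth_mult; [| apply smooth_id | exact Hal]; apply itv_open. }
    intros y Hy.
    assert (D' : Derive (fun y => - w 0 / INR (S p) + y * al y) y
                 = al y + y * Derive al y).
    { apply is_derive_unique; auto_derive; [apply (smooth_ex_derive (itv r)); assumption|].
      change (fun y => al y) with al; ring. }
    rewrite D', (E y Hy).
    specialize (D y Hy).
    replace (w1 y) with (y * Derive al y - INR p * al y + c * y ^ p) by lra.
    rewrite S_INR in *; simpl; field; exact Hp.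
Qed.

(** * A scalar implicit function theorem *)

(** Caratheodory's form of differentiability: the chord slopes extend
    continuously.  It turns the differentiation of an implicit function into
    algebra on slopes. *)
Lemma is_derive_slope (f : R -> R) (x l : R) :
  is_derive f x l ->
  exists phi, continuous phi x /\ phi x = l /\
    forall y : R, f y - f x = (y - x) * phi y.
Proof.
  intros D; apply is_derive_Reals in D.
  exists (fun y => if Req_EM_T y x then l else (f y - f x) / (y - x)).
  destruct (Req_EM_T x x) as [_|n]; [|now contradict n].
  split; [|split; [reflexivity|]].
  - apply continuity_pt_filterlim.
    intros eps He; destruct (D eps He) as [d Hd].
    exists d; split; [apply (cond_pos d)|].
    intros y [[_ Hyx] Hy]; simpl in *; unfold R_dist in *.
    destruct (Req_EM_T x x) as [_|n]; [|now contradict n].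
    destruct (Req_EM_T y x) as [e|n]; [now contradict Hyx|].
    replace (f y) with (f (x + (y - x))) by (f_equal; ring).
    apply Hd; [lra | exact Hy].
  - intros y; destruct (Req_EM_T y x) as [->|n]; [ring | field; lra].
Qed.

Lemma slope_is_derive (f : R -> R) (x : R) (phi : R -> R) :
  continuous phi x -> locally x (fun y : R => f y - f x = (y - x) * phi y) ->
  is_derive f x (phi x).
Proof.
  intros C [d Hd]; apply is_derive_Reals; intros eps He.
  apply continuity_pt_filterlim in C.
  destruct (C eps He) as [e [He0 Hphi]].
  assert (Hm : 0 < Rmin d e) by (apply Rmin_glb_lt; [apply (cond_pos d) | lra]).
  exists (mkposreal _ Hm); simpl; intros h Hh0 Hh.
  assert (Hhd : Rabs h < d) by (eapply Rlt_le_trans; [exact Hh | apply Rmin_l]).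
  assert (Hhe : Rabs h < e) by (eapply Rlt_le_trans; [exact Hh | apply Rmin_r]).
  rewrite Hd.
  2: { change (Rabs (x + h - x) < d); replace (x + h - x) with h by ring; auto. }
  replace ((x + h - x) * phi (x + h) / h) with (phi (x + h)) by (field; auto).
  apply Hphi; split; [split; [exact Logic.I | lra]|].
  simpl; unfold R_dist; replace (x + h - x) with h by ring; auto.
Qed.

Lemma continuous_nonzero (f : R -> R) x :
  continuous f x -> f x <> 0 -> locally x (fun y => f y <> 0).
Proof.
  intros C Hx; apply (C (fun z => z <> 0)).
  apply (open_neq 0 (f x) Hx).
Qed.

(** Subtracting the equations at [z] and at [y] and factoring each increment by
    its slope [S] gives
    [(v z - v y) * (SA (v z) + q z) = (z - y) * (Sg z - Sq z * v y)]. *)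
Lemma implicit_derivative (A q ga v : R -> R) y :
  ex_derive A (v y) -> ex_derive q y -> ex_derive ga y -> continuous v y ->
  Derive A (v y) + q y <> 0 ->
  locally y (fun z => A (v z) + q z * v z = ga z) ->
  is_derive v y ((Derive ga y - Derive q y * v y) / (Derive A (v y) + q y)).
Proof.
  intros DA Dq Dga Cv Hne E.
  destruct (is_derive_slope _ _ _ (Derive_correct _ _ DA)) as [SA [CA [VA EA]]].
  destruct (is_derive_slope _ _ _ (Derive_correct _ _ Dq)) as [Sq [Cq [Vq Eq]]].
  destruct (is_derive_slope _ _ _ (Derive_correct _ _ Dga)) as [Sg [Cg [Vg Eg]]].
  assert (Cden : continuous (fun z => SA (v z) + q z) y).
  { apply (continuous_plus (fun z => SA (v z)) q).
    - apply (continuous_comp v SA); assumption.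
    - apply (ex_derive_continuous q), Dq. }
  rewrite <- VA, <- Vq, <- Vg; rewrite <- VA in Hne.
  apply (slope_is_derive v y
           (fun z => (Sg z - Sq z * v y) / (SA (v z) + q z))).
  - apply (continuous_mult (fun z => Sg z - Sq z * v y)
                           (fun z => / (SA (v z) + q z))).
    + apply (continuous_minus Sg (fun z => Sq z * v y)); [exact Cg|].
      apply (continuous_mult Sq (fun _ => v y)); [exact Cq | apply continuous_const].
    + apply (continuous_comp (fun z => SA (v z) + q z) Rinv); [exact Cden|].
      apply continuity_pt_filterlim, (continuity_pt_inv (fun z => z));
        [apply derivable_continuous_pt, derivable_pt_id | exact Hne].
  - pose proof (locally_singleton _ _ E) as Ey; simpl in Ey.
    generalize (filter_and _ _ E (continuous_nonzero _ _ Cden Hne)).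
    apply filter_imp; intros z [Ez Hz].
    specialize (EA (v z)); specialize (Eq z); specialize (Eg z).
    apply (Rmult_eq_reg_r (SA (v z) + q z)); [|exact Hz].
    replace ((z - y) * ((Sg z - Sq z * v y) / (SA (v z) + q z)) * (SA (v z) + q z))
      with ((z - y) * Sg z - ((z - y) * Sq z) * v y) by (field; exact Hz).
    rewrite <- Eg, <- Eq, Rmult_plus_distr_l, <- EA, <- Ez, <- Ey; ring.
Qed.

(** Bootstrapping: the derivative of [v] is an expression in [v] and smooth
    functions, so it is as regular as [v] itself. *)
Lemma implicit_smooth (I J : R -> Prop) (A q ga v : R -> R) :
  open I -> smooth J A -> smooth I q -> smooth I ga ->
  (forall y, I y -> J (v y) /\ continuous v y /\ Derive A (v y) + q y <> 0) ->
  (forall y, I y -> A (v y) + q y * v y = ga y) ->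
  smooth I v.
Proof.
  intros HI HA Hq Hga Hv E n; induction n as [|n IH]; [exact Logic.I|].
  apply (diff_n_S I HI n _
    (fun y => (Derive ga y - Derive q y * v y) * / (Derive A (v y) + q y))).
  - intros y Hy; destruct (Hv y Hy) as [HJ [C N]].
    apply implicit_derivative; auto.
    + apply (smooth_ex_derive J); assumption.
    + apply (smooth_ex_derive I); assumption.
    + apply (smooth_ex_derive I); assumption.
    + apply filter_imp with (2 := HI y Hy); exact E.
  - assert (O : diff_n I n (fun y => Derive q y * v y)).
    { apply diff_n_mult; [exact HI | apply smooth_Derive, Hq | exact IH]. }
    apply diff_n_mult; [exact HI| |].
    + apply (diff_n_ext I HI n (fun y => Derive ga y + (-1) * (Derive q y * v y))).
      { intros; ring. }
      apply diff_n_plus; [exact HI | apply smooth_Derive, Hga|].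
      apply diff_n_mult; [exact HI | apply smooth_const, HI | exact O].
    + apply diff_n_inv; [exact HI | intros y Hy; apply Hv, Hy|].
      apply diff_n_plus; [exact HI| |apply Hq].
      apply (diff_n_comp I HI J); [intros y Hy; apply Hv, Hy | | exact IH].
      apply smooth_Derive, HA.
Qed.

(** An equation in which the parameter enters only through the coefficient of the
    linear term is general enough for inverse functions ([q = 0]) and for
    [exp v + q y * v = ga y], and it keeps the regularity argument within
    functions of one variable. *)
Lemma implicit_function (I J : R -> Prop) l r (A q ga : R -> R) :
  open I -> smooth J A -> smooth I q -> smooth I ga ->
  l < r -> (forall v, l <= v <= r -> J v) ->
  (forall y v, I y -> l <= v <= r -> 0 < Derive A v + q y) ->
  (forall y, I y -> A l + q y * l < ga y < A r + q y * r) ->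
  exists v, smooth I v /\
    forall y, I y -> l < v y < r /\ A (v y) + q y * v y = ga y.
Proof.
  intros HI HA Hq Hga Hlr HJ Hpos Hends.
  set (Phi := fun y v => A v + q y * v).
  assert (D : forall y v, l <= v <= r -> is_derive (Phi y) v (Derive A v + q y)).
  { intros y v Hv; unfold Phi; auto_derive.
    - apply (smooth_ex_derive J); auto.
    - change (fun v => A v) with A; ring. }
  assert (Mono : forall y s t, I y -> l <= s <= r -> l <= t <= r -> s < t ->
            Phi y s < Phi y t).
  { intros y s t Hy Hs Ht Hst.
    destruct (MVT_gen (Phi y) s t (fun v => Derive A v + q y)) as [c [Hc E]].
    - rewrite Rmin_left, Rmax_right by lra; intros v Hv; apply D; lra.
    - rewrite Rmin_left, Rmax_right by lra; intros v Hv.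
      apply continuity_pt_filterlim.
      apply (ex_derive_continuous (Phi y)); eexists; apply D; lra.
    - rewrite Rmin_left, Rmax_right in Hc by lra.
      assert (0 < Derive A c + q y) by (apply Hpos; [exact Hy | lra]).
      nra. }
  assert (Ex : forall y, exists v, I y -> l < v < r /\ Phi y v = ga y).
  { intros y; destruct (excluded_middle_informative (I y)) as [Hy|Hy].
    2: { exists 0; intros H; now contradict H. }
    destruct (Hends y Hy) as [H1 H2].
    destruct (IVT_interv (fun v => Phi y v - ga y) l r) as [v [Hv E]].
    - intros v Hv; apply continuity_pt_filterlim.
      apply (ex_derive_continuous (fun v => Phi y v - ga y)).
      apply (ex_derive_minus (Phi y)); [eexists; apply D, Hv | apply ex_derive_const].
    - exact Hlr.
    - unfold Phi; lra.
    - unfold Phi; lra.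
    - exists v; intros _.
      assert (v <> l) by (intros ->; unfold Phi in E; lra).
      assert (v <> r) by (intros ->; unfold Phi in E; lra).
      split; lra. }
  set (v := fun y => proj1_sig (constructive_indefinite_description _ (Ex y))).
  assert (Hv : forall y, I y -> l < v y < r /\ Phi y (v y) = ga y).
  { intros y; unfold v; destruct constructive_indefinite_description; auto. }
  exists v; split; [|exact Hv].
  apply (implicit_smooth I J A q ga v); auto; [|intros y Hy; apply Hv, Hy].
  intros y Hy; destruct (Hv y Hy) as [Hvy Ey].
  split; [apply HJ; lra|]; split; [|apply Rgt_not_eq, Hpos; [exact Hy | lra]].
  (* [v] is trapped between [v y - h] and [v y + h] as soon as the strict signs
     of [Phi - ga] at these two points persist. *)
  assert (Cs : forall s, continuous (fun z => Phi z s - ga z) y).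
  { intros s; apply (ex_derive_continuous (fun z => Phi z s - ga z)).
    unfold Phi; auto_derive; split; [|split; [|exact Logic.I]];
      apply (smooth_ex_derive I); assumption. }
  apply filterlim_locally; intros eps.
  set (h := Rmin eps (Rmin (v y - l) (r - v y)) / 2).
  assert (Hh : 0 < h /\ h < eps /\ l < v y - h /\ v y + h < r).
  { assert (0 < Rmin eps (Rmin (v y - l) (r - v y))).
    { repeat apply Rmin_glb_lt; [apply (cond_pos eps)|lra|lra]. }
    pose proof (Rmin_l eps (Rmin (v y - l) (r - v y))).
    pose proof (Rmin_r eps (Rmin (v y - l) (r - v y))).
    pose proof (Rmin_l (v y - l) (r - v y)).
    pose proof (Rmin_r (v y - l) (r - v y)).
    unfold h; repeat split; lra. }
  assert (L1 : locally y (fun z => Phi z (v y - h) - ga z < 0)).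
  { apply (Cs (v y - h) (fun t => t < 0)), open_lt.
    assert (Phi y (v y - h) < Phi y (v y)) by (apply Mono; [exact Hy|lra..]). lra. }
  assert (L2 : locally y (fun z => 0 < Phi z (v y + h) - ga z)).
  { apply (Cs (v y + h) (fun t => 0 < t)), open_gt.
    assert (Phi y (v y) < Phi y (v y + h)) by (apply Mono; [exact Hy|lra..]). lra. }
  generalize (filter_and _ _ (HI y Hy) (filter_and _ _ L1 L2)).
  apply filter_imp; intros z [Hz [H1 H2]].
  destruct (Hv z Hz) as [Hvz Ez].
  change (Rabs (v z - v y) < eps); apply Rabs_def1.
  - destruct (Rle_or_lt (v y + h) (v z)) as [[Hlt|Heq]|]; [| |lra].
    + assert (Phi z (v y + h) < Phi z (v z)) by (apply Mono; [exact Hz|lra..]); lra.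
    + rewrite Heq in H2; lra.
  - destruct (Rle_or_lt (v z) (v y - h)) as [[Hlt|Heq]|]; [| |lra].
    + assert (Phi z (v z) < Phi z (v y - h)) by (apply Mono; [exact Hz|lra..]); lra.
    + rewrite <- Heq in H1; lra.
Qed.

Lemma inverse_function t F :
  0 < t -> smooth (itv t) F -> (forall y, itv t y -> 0 < Derive F y) ->
  exists e (K : R -> Prop) g, 0 < e <= t /\ open K /\ smooth K g /\
    (forall y, itv e y -> K (F y) /\ g (F y) = y) /\
    (forall z, K z -> itv e (g z) /\ F (g z) = z).
Proof.
  intros Ht SF DF.
  (* Half the interval, so that [Derive F] is still positive at the end points. *)
  set (e := t / 2); assert (He : 0 < e < t) by (unfold e; lra).
  set (K := fun z => F (- e) < z < F e).
  assert (OK : open K) by (apply open_and; [apply open_gt | apply open_lt]).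
  assert (B : forall y, - e <= y <= e -> itv t y) by (unfold itv; intros; lra).
  assert (Mono : forall x y, - e <= x -> x < y -> y <= e -> F x < F y).
  { intros x y Hx Hxy Hy.
    apply (incr_function F (- t) t (Derive F)); simpl; try lra.
    - intros; apply (smooth_is_derive (itv t)); [exact SF | split; assumption].
    - intros; apply DF; split; assumption. }
  destruct (implicit_function K (itv t) (- e) e F (fun _ => 0) (fun z => z))
    as [g [Sg Hg]].
  - exact OK.
  - exact SF.
  - apply smooth_const, OK.
  - apply smooth_id, OK.
  - lra.
  - exact B.
  - intros _ v _ Hv; rewrite Rplus_0_r; apply DF, B, Hv.
  - unfold K; intros z Hz; lra.
  - assert (Hg' : forall z, K z -> itv e (g z) /\ F (g z) = z).
    { intros z Hz; destruct (Hg z Hz); split; [assumption | lra]. }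
    exists e, K, g; split; [lra|]; split; [exact OK|]; split; [exact Sg|].
    split; [|exact Hg'].
    intros y [Hy1 Hy2].
    assert (Ky : K (F y)) by (split; apply Mono; lra).
    split; [exact Ky|].
    destruct (Hg' _ Ky) as [[G1 G2] EG].
    destruct (Rtotal_order (g (F y)) y) as [H|[H|H]]; [|exact H|].
    + apply Mono in H; lra.
    + apply Mono in H; lra.
Qed.

(** * Order of vanishing *)

(** [Derive (y ^ (k + 1) * u)] is again of the form [y ^ k * w], with
    [w 0 = (k + 1) * u 0]. *)
Lemma Derive_n_pow_mult r k u :
  0 < r -> smooth (itv r) u ->
  Derive_n (fun y => y ^ k * u y) k 0 = INR (fact k) * u 0.
Proof.
  intros Hr; revert u; induction k as [|k IH]; intros u U; [simpl; ring|].
  assert (Y : smooth (itv r) (fun y => y * Derive u y)).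
  { apply smooth_mult; [apply itv_open | apply smooth_id, itv_open|].
    apply smooth_Derive, U. }
  pose proof (Derive_n_comp (fun y => y ^ S k * u y) k 1 0) as C.
  rewrite Nat.add_1_r in C; rewrite <- C.
  rewrite (Derive_n_ext_loc _ (fun y => y ^ k * (INR (S k) * u y + y * Derive u y))).
  - rewrite IH.
    + rewrite fact_simpl, mult_INR; ring.
    + apply smooth_plus; [apply itv_open| |exact Y].
      apply smooth_mult; [apply itv_open | apply smooth_const, itv_open | exact U].
  - apply filter_imp with (2 := itv_open r 0 (itv_0 r Hr)); intros y Hy.
    simpl Derive_n; apply is_derive_unique; auto_derive.
    + apply (smooth_ex_derive (itv r)); assumption.
    + change (fun y => u y) with u; rewrite S_INR.
      destruct k as [|k]; simpl pred; simpl pow; [simpl INR|]; ring.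
Qed.

Lemma vanishing_order_factor r k f :
  0 < r -> smooth (itv r) f ->
  (forall j, (j < k)%nat -> Derive_n f j 0 = 0) ->
  exists u, smooth (itv r) u /\ (forall y, itv r y -> f y = y ^ k * u y) /\
    Derive_n f k 0 = INR (fact k) * u 0.
Proof.
  intros Hr F V.
  enough (H : exists u, smooth (itv r) u /\ (forall y, itv r y -> f y = y ^ k * u y)).
  { destruct H as [u [U E]]; exists u; repeat split; auto.
    rewrite <- (Derive_n_pow_mult r k u Hr U); apply Derive_n_ext_loc.
    apply filter_imp with (2 := itv_open r 0 (itv_0 r Hr)); exact E. }
  induction k as [|k IH].
  - exists f; split; [exact F | intros; simpl; ring].
  - destruct IH as [u [U E]]; [intros j Hj; apply V; lia|].
    assert (u0 : u 0 = 0).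
    { assert (H : Derive_n f k 0 = INR (fact k) * u 0).
      { rewrite <- (Derive_n_pow_mult r k u Hr U); apply Derive_n_ext_loc.
        apply filter_imp with (2 := itv_open r 0 (itv_0 r Hr)); exact E. }
      rewrite V in H by lia.
      pose proof (INR_fact_neq_0 k).
      destruct (Rmult_integral _ _ (eq_sym H)); [contradiction | assumption]. }
    destruct (smooth_divide r u U) as [g [G Eg]].
    exists g; split; [exact G|].
    intros y Hy; rewrite (E y Hy), (Eg y Hy), u0; simpl; ring.
Qed.

(** * Conjugacy of fields on the line *)

(** The equation says that [F] carries the field [f d/dy] to [h d/dz]. *)
Definition line_conjugator (r : R) (f h F : R -> R) : Prop :=
  smooth (itv r) F /\ F 0 = 0 /\ Derive F 0 = 1 /\
  forall y, itv r y -> Derive F y * f y = h (F y).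

(** Away from its zeros a field is straightened by the primitive of
    [f 0 / f]. *)
Lemma line_conjugate_const r f :
  0 < r -> smooth (itv r) f -> f 0 <> 0 ->
  exists s F, 0 < s <= r /\ line_conjugator s f (fun _ => f 0) F.
Proof.
  intros Hr Sf f0.
  destruct (locally_itv r _ Hr (continuous_nonzero f 0
             (smooth_continuous _ _ _ Sf (itv_0 r Hr)) f0)) as [s [Hs N]].
  assert (Sf' : smooth (itv s) f).
  { apply (smooth_incl (itv r)); [|exact Sf]; intros y; apply itv_incl; lra. }
  destruct (smooth_antiderivative s (fun y => f 0 * / f y)) as [F [F0 [SF DF]]].
  { apply smooth_mult; [apply itv_open | apply smooth_const, itv_open|].
    apply smooth_inv; [apply itv_open | exact N | exact Sf']. }
  exists s, F; split; [exact Hs|]; split; [exact SF|]; split; [exact F0|].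
  assert (Hs0 : itv s 0) by (apply itv_0; lra).
  split.
  - rewrite (is_derive_unique _ _ _ (DF 0 Hs0)); field; exact f0.
  - intros y Hy; rewrite (is_derive_unique _ _ _ (DF y Hy)); field; auto.
Qed.

(** With [dy / f y = d (al y) + dy / (a * y)], the primitive
    [log |y| + a * al y] of [a dy / f y] must become [log |F|], up to the constant
    that makes [F] tangent to the identity. *)
Lemma line_conjugate_linear r f u :
  0 < r -> smooth (itv r) u -> u 0 <> 0 -> (forall y, itv r y -> f y = y * u y) ->
  exists s F, 0 < s <= r /\ line_conjugator s f (fun z => u 0 * z) F.
Proof.
  intros Hr Su u0 Ef.
  destruct (locally_itv r _ Hr (continuous_nonzero u 0
             (smooth_continuous _ _ _ Su (itv_0 r Hr)) u0)) as [s [Hs N]].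
  assert (Su' : smooth (itv s) u).
  { apply (smooth_incl (itv r)); [|exact Su]; intros y; apply itv_incl; lra. }
  assert (Hs0 : itv s 0) by (apply itv_0; lra).
  assert (Os := itv_open s).
  destruct (euler_equation s 0 (fun y => / u y)) as [c [al [Sal E]]].
  { apply smooth_inv; assumption. }
  assert (Hc : c = / u 0) by (specialize (E 0 Hs0); simpl in E; lra).
  set (F := fun y => y * exp (u 0 * (al y - al 0))).
  assert (DF : forall y, itv s y -> is_derive F y
            (exp (u 0 * (al y - al 0)) * (1 + u 0 * (y * Derive al y)))).
  { intros y Hy; unfold F; auto_derive.
    - apply (smooth_ex_derive (itv s)); assumption.
    - change (fun y => al y) with al; unfold Rminus; ring. }
  exists s, F; split; [exact Hs|].
  split; [|split; [|split]].
  - apply smooth_mult; [exact Os | apply smooth_id, Os|].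
    apply (smooth_comp _ Os (fun _ => True) exp); [trivial | |].
    + apply smooth_exp, open_true.
    + apply smooth_mult; [exact Os | apply smooth_const, Os|].
      apply smooth_minus; [exact Os | exact Sal | apply smooth_const, Os].
  - unfold F; ring.
  - rewrite (is_derive_unique _ _ _ (DF 0 Hs0)).
    rewrite Rminus_diag, Rmult_0_r, exp_0; ring.
  - intros y Hy; rewrite (is_derive_unique _ _ _ (DF y Hy)).
    rewrite Ef by (apply (itv_incl r s); [lra | exact Hy]).
    replace (y * Derive al y) with (/ u y - / u 0)
      by (rewrite <- Hc; specialize (E y Hy); simpl in E; lra).
    unfold F; field; auto.
Qed.

(** Near [0] the left-hand side increases with [v] on [[-1, 1]], because
    [exp v >= 1/3 > 1/4 > - q y], and it runs through a neighbourhood of [1]. *)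
Lemma exp_plus_small_implicit s q ga :
  0 < s -> smooth (itv s) q -> smooth (itv s) ga -> q 0 = 0 -> ga 0 = 1 ->
  exists t v, 0 < t <= s /\ smooth (itv t) v /\ v 0 = 0 /\
    forall y, itv t y -> 0 < exp (v y) + q y /\ exp (v y) + q y * v y = ga y.
Proof.
  intros Hs Sq Sga q0 ga0.
  assert (Hs0 := itv_0 s Hs).
  assert (Lq : locally 0 (fun y => -1/4 < q y < 1/4)).
  { apply (smooth_continuous _ _ _ Sq Hs0 (fun z => -1/4 < z < 1/4)).
    rewrite q0; apply (open_and _ _ (open_gt (-1/4)) (open_lt (1/4))); lra. }
  assert (Lg : locally 0 (fun y => 3/4 < ga y < 5/4)).
  { apply (smooth_continuous _ _ _ Sga Hs0 (fun z => 3/4 < z < 5/4)).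
    rewrite ga0; apply (open_and _ _ (open_gt (3/4)) (open_lt (5/4))); lra. }
  destruct (locally_itv s _ Hs (filter_and _ _ Lq Lg)) as [t [Ht B]].
  assert (e1 : 2 < exp 1 <= 3).
  { split; [pose proof (exp_ineq1 1); lra | apply exp_le_3]. }
  assert (em1 : 1/3 <= exp (-1) < 1/2).
  { change (exp (-1)) with (exp (- (1))); rewrite exp_Ropp; split.
    - replace (1/3) with (/3) by lra; apply Rinv_le_contravar; lra.
    - replace (1/2) with (/2) by lra; apply Rinv_lt_contravar; lra. }
  assert (Hexp : forall v, -1 <= v -> 1/3 <= exp v).
  { intros v [Hv| <-]; [|lra]; apply exp_increasing in Hv; lra. }
  destruct (implicit_function (itv t) (fun _ => True) (-1) 1 exp q ga)
    as [v [Sv Hv]].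
  - apply itv_open.
  - apply smooth_exp, open_true.
  - apply (smooth_incl (itv s)); [intros y; apply itv_incl; lra | exact Sq].
  - apply (smooth_incl (itv s)); [intros y; apply itv_incl; lra | exact Sga].
  - lra.
  - trivial.
  - intros y v Hy Hv; rewrite (is_derive_unique _ _ _ (is_derive_exp v)).
    specialize (Hexp v (proj1 Hv)); specialize (B y Hy); lra.
  - intros y Hy; specialize (B y Hy); lra.
  - exists t, v; split; [exact Ht|]; split; [exact Sv|]; split.
    + destruct (Hv 0 (itv_0 t (proj1 Ht))) as [_ E].
      rewrite q0, ga0 in E; apply exp_inv; rewrite exp_0; lra.
    + intros y Hy; destruct (Hv y Hy) as [Hvy E]; split; [|exact E].
      assert (1/3 <= exp (v y)) by (apply Hexp; lra).
      specialize (B y Hy); lra.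
Qed.

Lemma exp_INR_mult p x : exp (INR p * x) = exp x ^ p.
Proof.
  induction p as [|p IH]; [simpl; rewrite Rmult_0_l; apply exp_0|].
  rewrite S_INR, Rmult_plus_distr_r, exp_plus, IH, Rmult_1_l; simpl; ring.
Qed.

(** A primitive of [dz / (a * z ^ k + d * z ^ (2 * k - 1))] is
    [- z ^ (- p) / (a * p) + d / (a ^ 2 * p) * log |a * z ^ (- p) + d|] with
    [p = k - 1].  Equating it at [z = y * m] with the primitive
    [y ^ (- p) * al y + c * log |y|] of [dy / f y], where [c = - d / a ^ 2], and
    multiplying by [- a * p * y ^ p], the terms in [log |y|] cancel; with
    [n = m ^ (- p)] and [q = c * a * y ^ p] there remains, up to the choice of the
    constant of integration,
    [n + q * log (n - q) = - a * p * al y].  Setting [v = log (n - q)], this is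
    the implicit equation [exp v + q * v = - a * p * al y - q]. *)
Lemma line_conjugate_power r k f u :
  (2 <= k)%nat -> 0 < r -> smooth (itv r) u -> u 0 <> 0 ->
  (forall y, itv r y -> f y = y ^ k * u y) ->
  exists d s F, 0 < s <= r /\
    line_conjugator s f (fun z => u 0 * z ^ k + d * z ^ (2 * k - 1)) F.
Proof.
  intros Hk Hr Su u0 Ef.
  destruct k as [|p]; [lia|]; assert (Hp : (1 <= p)%nat) by lia; clear Hk.
  assert (Hp0 : INR p <> 0) by (apply not_0_INR; lia).
  set (a := u 0) in *.
  destruct (locally_itv r _ Hr (continuous_nonzero u 0
             (smooth_continuous _ _ _ Su (itv_0 r Hr)) u0)) as [s [Hs N]].
  assert (Su' : smooth (itv s) u).
  { apply (smooth_incl (itv r)); [|exact Su]; intros y; apply itv_incl; lra. }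
  assert (Hs0 : itv s 0) by (apply itv_0; lra).
  destruct (euler_equation s p (fun y => / u y)) as [c [al [Sal E]]].
  { apply smooth_inv; [apply itv_open | exact N | exact Su']. }
  assert (E0 : a * INR p * al 0 = -1).
  { specialize (E 0 Hs0); cbv beta in E; rewrite pow_i in E by lia; fold a in E.
    rewrite Rmult_assoc; replace (INR p * al 0) with (- / a) by lra.
    field; exact u0. }
  set (q := fun y => c * a * y ^ p).
  set (ga := fun y => - (a * INR p) * al y - q y).
  assert (Sq : smooth (itv s) q).
  { apply smooth_mult; [apply itv_open | apply smooth_const, itv_open|].
    apply (smooth_pow _ (itv_open s) (fun y => y)), smooth_id, itv_open. }
  assert (Sga : smooth (itv s) ga).
  { apply smooth_minus; [apply itv_open| |exact Sq].
    apply smooth_mult; [apply itv_open | apply smooth_const, itv_open | exact Sal]. }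
  assert (q0 : q 0 = 0) by (unfold q; rewrite pow_i by lia; ring).
  assert (ga0 : ga 0 = 1) by (unfold ga; rewrite q0; lra).
  destruct (exp_plus_small_implicit s q ga (proj1 Hs) Sq Sga q0 ga0)
    as [t [v [Ht [Sv [v0 Hv]]]]].
  assert (Ot := itv_open t).
  assert (Ht0 : itv t 0) by (apply itv_0; lra).
  assert (Hts : forall y, itv t y -> itv s y) by (intros y; apply itv_incl; lra).
  assert (Sal' := smooth_incl _ _ _ Hts Sal).
  assert (Sq' := smooth_incl _ _ _ Hts Sq).
  set (n := fun y => exp (v y) + q y).
  assert (Sn : smooth (itv t) n).
  { apply smooth_plus; [exact Ot| |exact Sq'].
    apply (smooth_comp _ Ot (fun _ => True) exp); [trivial| |exact Sv].
    apply smooth_exp, open_true. }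
  set (m := fun y => exp (- / INR p * ln (n y))).
  assert (Sm : smooth (itv t) m).
  { apply (smooth_comp _ Ot (fun _ => True) exp); [trivial| |].
    - apply smooth_exp, open_true.
    - apply smooth_mult; [exact Ot | apply smooth_const, Ot|].
      apply smooth_ln; [exact Ot| |exact Sn]; intros y Hy; apply Hv, Hy. }
  assert (Hm : forall y, itv t y -> m y ^ p = / n y).
  { intros y Hy; unfold m; rewrite <- exp_INR_mult.
    replace (INR p * (- / INR p * ln (n y))) with (- ln (n y)) by (field; exact Hp0).
    rewrite exp_Ropp, exp_ln; [reflexivity | apply Hv, Hy]. }
  assert (n0 : n 0 = 1) by (unfold n; rewrite v0, q0, exp_0; ring).
  assert (m0 : m 0 = 1).
  { unfold m; rewrite n0, ln_1, Rmult_0_r; apply exp_0. }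
  (* By the equation of [al], the operator [y * d/dy] sends [q], [v] and [n] to
     algebraic expressions in [y], [u] and these functions. *)
  assert (Dq : forall y, itv t y -> y * Derive q y = INR p * q y).
  { intros y Hy.
    assert (D : Derive q y = c * a * (INR p * y ^ pred p)).
    { apply is_derive_unique; unfold q; auto_derive; [exact Logic.I | ring]. }
    rewrite D; unfold q; destruct p as [|p']; [lia|].
    simpl pred; simpl pow; ring. }
  assert (Dv : forall y, itv t y ->
            y * Derive v y * n y = INR p * (n y - a * / u y)).
  { intros y Hy; destruct (Hv y Hy) as [_ En].
    assert (D : Derive (fun y => exp (v y) + q y * v y) y = Derive ga y).
    { apply Derive_ext_loc; apply filter_imp with (2 := Ot y Hy).
      intros z Hz; apply Hv, Hz. }
    assert (D1 : Derive (fun y => exp (v y) + q y * v y) y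
                 = Derive v y * exp (v y) + (Derive q y * v y + q y * Derive v y)).
    { apply is_derive_unique; auto_derive.
      - repeat split; apply (smooth_ex_derive (itv t)); assumption.
      - change (fun y => v y) with v; change (fun y => q y) with q; ring. }
    assert (D2 : Derive ga y = - (a * INR p) * Derive al y - Derive q y).
    { apply is_derive_unique; unfold ga; auto_derive.
      - repeat split; apply (smooth_ex_derive (itv t)); assumption.
      - change (fun y => al y) with al; change (fun y => q y) with q; ring. }
    rewrite D1, D2 in D; apply (f_equal (Rmult y)) in D.
    specialize (E y (Hts y Hy)); cbv beta in E; specialize (Dq y Hy).
    assert (Eq : q y = a * (c * y ^ p)) by (unfold q; ring).
    unfold ga in En; unfold n.
    replace (y * (Derive v y * exp (v y) + (Derive q y * v y + q y * Derive v y)))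
      with (y * Derive v y * (exp (v y) + q y) + (y * Derive q y) * v y) in D by ring.
    replace (y * (- (a * INR p) * Derive al y - Derive q y))
      with (- (a * INR p) * (y * Derive al y) - y * Derive q y) in D by ring.
    replace (y * Derive al y) with (INR p * al y + / u y - c * y ^ p) in D by lra.
    rewrite Dq in D.
    replace (y * Derive v y * (exp (v y) + q y)) with
      (- (a * INR p) * (INR p * al y + / u y - c * y ^ p) - INR p * q y
       - INR p * q y * v y) by lra.
    replace (exp (v y)) with (- (a * INR p) * al y - q y - q y * v y) by lra.
    rewrite Eq; ring. }
  assert (Dn : forall y, itv t y ->
            y * Derive n y = INR p * (n y - a * / u y * (1 - q y / n y))).
  { intros y Hy; destruct (Hv y Hy) as [Pn _]; fold (n y) in Pn.
    assert (D : Derive n y = Derive v y * exp (v y) + Derive q y).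
    { apply is_derive_unique; unfold n; auto_derive.
      - repeat split; apply (smooth_ex_derive (itv t)); assumption.
      - change (fun y => v y) with v; change (fun y => q y) with q; ring. }
    rewrite D; specialize (Dv y Hy); specialize (Dq y Hy).
    replace (exp (v y)) with (n y - q y) by (unfold n; ring).
    replace (y * (Derive v y * (n y - q y) + Derive q y))
      with ((y * Derive v y * n y) * (n y - q y) / n y + y * Derive q y)
      by (field; lra).
    rewrite Dv, Dq; field; split; [lra | apply N, Hts, Hy]. }
  set (F := fun y => y * m y).
  assert (DF : forall y, itv t y ->
            Derive F y = m y * (a * / u y / n y * (1 - q y / n y))).
  { intros y Hy; destruct (Hv y Hy) as [Pn _]; fold (n y) in Pn.
    assert (D : Derive F y = m y * (1 - y * Derive n y / (INR p * n y))).
    { apply is_derive_unique; unfold F, m; auto_derive.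
      - split; [apply (smooth_ex_derive (itv t)); assumption | auto].
      - change (fun y => n y) with n; field; split; [lra | exact Hp0]. }
    rewrite D, (Dn y Hy); field.
    repeat split; [lra | apply N, Hts, Hy | exact Hp0]. }
  exists (- (c * a ^ 2)), t, F; split; [lra|].
  split; [|split; [|split]].
  - apply smooth_mult; [exact Ot | apply smooth_id, Ot | exact Sm].
  - unfold F; ring.
  - rewrite (DF 0 Ht0), m0, n0, q0; fold a; field; exact u0.
  - intros y Hy; rewrite (DF y Hy).
    rewrite Ef by (apply (itv_incl r t); [lra | exact Hy]).
    destruct (Hv y Hy) as [Pn _]; fold (n y) in Pn.
    assert (Nu : u y <> 0) by apply N, Hts, Hy.
    replace (2 * S p - 1)%nat with (S p + p)%nat by lia.
    unfold F; rewrite pow_add, !Rpow_mult_distr; simpl pow.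
    rewrite (Hm y Hy); unfold q; field; split; [lra | exact Nu].
Qed.

(** * Fields that preserve the form *)

(** All the maps and fields of the plane that occur have components affine in [x]
    with coefficients depending on [y] only; this class is closed under both
    partial derivatives. *)
Lemma ex_diff_n_affine_mult I A al be c n x y :
  open I -> smooth I A -> I y ->
  ex_diff_n (fun u v => (al + be * u) * A v + c) n x y.
Proof.
  intros HI HA Hy; revert A al be c HA; induction n as [|n IH]; intros A al be c HA.
  all: assert (C : continuity_2d_pt (fun u v => (al + be * u) * A v + c) x y).
  1, 3: apply continuity_2d_pt_plus; [|apply continuity_2d_pt_const];
    apply continuity_2d_pt_mult;
    [ apply continuity_2d_pt_plus; [apply continuity_2d_pt_const|];
      apply continuity_2d_pt_mult;
      [apply continuity_2d_pt_const | apply continuity_2d_pt_id1]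
    | apply (continuity_1d_2d_pt_comp A (fun _ v => v));
      [ apply continuity_pt_filterlim, (smooth_continuous I); assumption
      | apply continuity_2d_pt_id2 ] ].
  - split; [exact C | exact Logic.I].
  - simpl; split; [exact C|]; split; [|split; [|split]].
    + auto_derive; exact Logic.I.
    + auto_derive; apply (smooth_ex_derive I); assumption.
    + apply (ex_diff_n_ext_loc (fun u v => (be + 0 * u) * A v + 0)); [|apply IH, HA].
      apply locally_2d_forall; intros u v; symmetry.
      apply is_derive_unique; auto_derive; [exact Logic.I | ring].
    + apply (ex_diff_n_ext_loc (fun u v => (al + be * u) * Derive A v + 0)).
      2: { apply IH, smooth_Derive, HA. }
      destruct (HI y Hy) as [d Hd]; exists d; intros u v _ Hv; symmetry.
      apply is_derive_unique; auto_derive.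
      * apply (smooth_ex_derive I); [exact HA | apply Hd, Hv].
      * change (fun v => A v) with A; ring.
Qed.

Lemma ex_diff_n_diff_n I Q n x :
  (forall y, I y -> ex_diff_n Q n x y) -> diff_n I n (fun y => Q x y).
Proof.
  revert Q; induction n as [|n IH]; intros Q H; [exact Logic.I|].
  split; [intros y Hy; apply (H y Hy)|].
  apply (IH (fun u v => Derive (fun z => Q u z) v)).
  intros y Hy; apply (H y Hy).
Qed.

Lemma Lie_derivative_mu X p :
  Lie_derivative X mu p =
    ((1 + fst p) * pdx (comp2 X) p, fst (X p) + (1 + fst p) * pdy (comp2 X) p).
Proof.
  assert (D1 : pdx (comp1 mu) p = 0).
  { unfold pdx, comp1, mu; simpl; apply Derive_const. }
  assert (D2 : pdy (comp1 mu) p = 0).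
  { unfold pdy, comp1, mu; simpl; apply Derive_const. }
  assert (D3 : pdx (comp2 mu) p = 1).
  { unfold pdx, comp2, mu; simpl; apply is_derive_unique.
    auto_derive; [exact I | ring]. }
  assert (D4 : pdy (comp2 mu) p = 0).
  { unfold pdy, comp2, mu; simpl; apply Derive_const. }
  unfold Lie_derivative; rewrite D1, D2, D3, D4; unfold mu; simpl.
  f_equal; ring.
Qed.

Lemma preserving_mu_partials U X p :
  nbhd U -> preserving_on U mu X -> U p ->
  pdx (comp2 X) p = 0 /\ fst (X p) = - (1 + fst p) * pdy (comp2 X) p.
Proof.
  intros [_ [_ HU]] [_ HX] Hp; specialize (HX p Hp).
  rewrite Lie_derivative_mu in HX.
  assert (N : 1 + fst p <> 0) by (specialize (HU p Hp); lra).
  injection HX; intros H2 H1; split; [|lra].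
  destruct (Rmult_integral _ _ H1); [contradiction | assumption].
Qed.

(** At a zero of [X] both partial derivatives of the second component vanish, so
    the linearization is singular and has the eigenvalue 0. *)
Lemma preserving_mu_not_hyperbolic U X p :
  nbhd U -> preserving_on U mu X -> U p -> ~ hyperbolic_singularity X p.
Proof.
  intros HU HX Hp [Hs Hh].
  destruct (preserving_mu_partials U X p HU HX Hp) as [Dx Dy].
  unfold singularity in Hs; rewrite Hs in Dy; simpl in Dy.
  destruct HU as [_ [_ HU]]; specialize (HU p Hp).
  assert (Dy0 : pdy (comp2 X) p = 0).
  { destruct (Rmult_integral (1 + fst p) (pdy (comp2 X) p)); lra. }
  apply (Hh (RtoC 0)); [|reflexivity].
  assert (K : exists v w : R, (v, w) <> (0, 0) /\
                pdx (comp1 X) p * v + pdy (comp1 X) p * w = 0).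
  { destruct (Req_dec (pdx (comp1 X) p) 0) as [E|E].
    - exists 1, 0; split; [intros H; injection H; lra | rewrite E; ring].
    - exists (pdy (comp1 X) p), (- pdx (comp1 X) p).
      split; [intros H; injection H; lra | ring]. }
  destruct K as [v [w [Nvw Evw]]].
  exists (RtoC v), (RtoC w); split.
  - intros H; injection H; intros; apply Nvw; subst; reflexivity.
  - rewrite Dx, Dy0; split.
    + rewrite <- !RtoC_mult, <- RtoC_plus, Evw, Rmult_0_l; reflexivity.
    + ring.
Qed.

(** The field with second component [h y] that preserves [mu]. *)
Definition line_lift (h : R -> R) : vector_field :=
  fun p => (- (1 + fst p) * Derive h (snd p), h (snd p)).

(** On a box around the origin the second component does not depend on [x], by
    the mean value theorem along horizontal segments; it is the function [f], and
    the other equation gives the first component. *)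
Lemma preserving_mu_line_lift X :
  in_fields mu X ->
  exists r f, 0 < r /\ smooth (itv r) f /\
    forall x y, itv r x -> itv r y -> X (x, y) = line_lift f (x, y).
Proof.
  intros [U [HU HX]].
  pose proof HU as [OU [U0 _]].
  assert (L : locally_2d (fun x y => U (x, y)) 0 0).
  { apply locally_2d_locally; generalize (OU _ U0).
    apply filter_imp; intros [x y]; trivial. }
  destruct L as [d Hd].
  assert (Hd' : forall x y, itv d x -> itv d y -> U (x, y)).
  { unfold itv; intros; apply Hd; apply Rabs_def1; lra. }
  assert (d0 := cond_pos d).
  exists d, (fun y => comp2 X 0 y); split; [exact d0|].
  assert (Q : forall x y, itv d x -> itv d y -> comp2 X x y = comp2 X 0 y).
  { intros x y Hx Hy.
    assert (B : forall c, Rmin 0 x <= c <= Rmax 0 x -> itv d c).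
    { intros c; unfold itv, Rmin, Rmax in *; destruct Rle_dec; lra. }
    assert (D : forall c, itv d c -> is_derive (fun t => comp2 X t y) c 0).
    { intros c Hc; assert (Hcy := Hd' c y Hc Hy).
      rewrite <- (proj1 (preserving_mu_partials U X _ HU HX Hcy)).
      apply Derive_correct.
      apply (proj2 (proj1 HX _ Hcy 1%nat)). }
    destruct (MVT_gen (fun t => comp2 X t y) 0 x (fun _ => 0)) as [c [_ Ec]].
    - intros c Hc; apply D, B; lra.
    - intros c Hc; apply continuity_pt_filterlim.
      apply (ex_derive_continuous (fun t => comp2 X t y)).
      exists 0; apply D, B, Hc.
    - lra. }
  split.
  - intros n; apply ex_diff_n_diff_n; intros y Hy.
    apply (proj1 HX (0, y)); apply Hd'; [apply itv_0, d0 | exact Hy].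
  - intros x y Hx Hy; assert (Hxy := Hd' x y Hx Hy).
    rewrite (surjective_pairing (X (x, y))).
    rewrite (proj2 (preserving_mu_partials U X _ HU HX Hxy)).
    unfold line_lift; simpl; f_equal; [|apply Q; assumption].
    f_equal; unfold pdy; simpl; apply Derive_ext_loc.
    apply filter_imp with (2 := itv_open d y Hy); intros z Hz; apply Q; assumption.
Qed.

Lemma open_half_strip (K : R -> Prop) :
  open K -> open (fun p : R * R => -1 < fst p /\ K (snd p)).
Proof.
  intros HK; apply open_and.
  - apply (open_comp (fun p : R * R => fst p) (fun x => -1 < x)).
    + intros p _; apply continuous_fst.
    + apply open_gt.
  - apply (open_comp (fun p : R * R => snd p) K); [|exact HK].
    intros p _; apply continuous_snd.
Qed.

Lemma nbhd_half_strip (K : R -> Prop) :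
  open K -> K 0 -> nbhd (fun p => -1 < fst p /\ K (snd p)).
Proof.
  intros HK K0; split; [apply open_half_strip, HK|]; split.
  - split; [simpl; lra | exact K0].
  - intros p Hp; lra.
Qed.

Lemma line_lift_in_fields Y h :
  smooth (fun _ => True) h -> (forall p, Y p = line_lift h p) -> in_fields mu Y.
Proof.
  intros Sh E; assert (O : open (fun _ : R => True)) by apply open_true.
  exists (fun p => -1 < fst p /\ True); split; [apply (nbhd_half_strip (fun _ => True)); trivial|].
  split.
  - intros [x y] _ n; split.
    + apply (ex_diff_n_ext_loc (fun u v => (-1 + (-1) * u) * Derive h v + 0)).
      * apply locally_2d_forall; intros u v; unfold comp1; rewrite E; simpl; ring.
      * apply (ex_diff_n_affine_mult (fun _ => True)); auto using smooth_Derive.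
    + apply (ex_diff_n_ext_loc (fun u v => (1 + 0 * u) * h v + 0)).
      * apply locally_2d_forall; intros u v; unfold comp2; rewrite E; simpl; ring.
      * apply (ex_diff_n_affine_mult (fun _ => True)); auto.
  - intros [x y] _; rewrite Lie_derivative_mu.
    assert (Dx : pdx (comp2 Y) (x, y) = 0).
    { unfold pdx, comp2; simpl; rewrite <- (Derive_const (h y) x).
      apply Derive_ext; intros t; rewrite E; reflexivity. }
    assert (Dy : pdy (comp2 Y) (x, y) = Derive h y).
    { unfold pdy, comp2; simpl; apply Derive_ext; intros t; rewrite E; reflexivity. }
    rewrite Dx, Dy, E; simpl; f_equal; ring.
Qed.

(** With [g] the inverse of [F], the lift
    [phi (x, z) = ((1 + x) * F' (g z) - 1, g z)] preserves [mu] because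
    [g' z = / F' (g z)].  The second component of the conjugacy equation is the
    equation of [F]; the first one follows by differentiating it. *)
Lemma line_lift_conjugate X Y f h r s F :
  in_fields mu X -> 0 < s <= r -> smooth (itv r) f ->
  (forall x y, itv r x -> itv r y -> X (x, y) = line_lift f (x, y)) ->
  smooth (fun _ => True) h -> (forall p, Y p = line_lift h p) ->
  line_conjugator s f h F ->
  conjugate mu X Y.
Proof.
  intros HX Hs Sf EX Sh EY [SF [F0 [DF0 HF]]].
  split; [exact HX|]; split; [apply (line_lift_in_fields Y h); assumption|].
  assert (Hs0 := itv_0 s (proj1 Hs)).
  assert (L : locally 0 (fun y => 0 < Derive F y)).
  { apply (smooth_continuous _ _ _ (smooth_Derive _ _ SF) Hs0 (fun z => 0 < z)).
    apply open_gt; rewrite DF0; lra. }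
  destruct (locally_itv s _ (proj1 Hs) L) as [t [Ht Pos]].
  assert (SF' : smooth (itv t) F).
  { apply (smooth_incl (itv s)); [intros y; apply itv_incl; lra | exact SF]. }
  destruct (inverse_function t F (proj1 Ht) SF' Pos)
    as [e [K [g [He [OK [Sg [HgF HFg]]]]]]].
  assert (Het : forall y, itv e y -> itv t y) by (intros y; apply itv_incl; lra).
  assert (Hes : forall y, itv e y -> itv s y) by (intros y; apply itv_incl; lra).
  assert (Her : forall y, itv e y -> itv r y) by (intros y; apply itv_incl; lra).
  destruct (HgF 0 (itv_0 e (proj1 He))) as [K0 g0]; rewrite F0 in K0, g0.
  set (A := fun z => Derive F (g z)).
  assert (SA : smooth K A).
  { apply (smooth_comp K OK (itv e) (Derive F)); [intros z Hz; apply HFg, Hz| |exact Sg].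
    apply smooth_Derive, (smooth_incl (itv s)); [exact Hes | exact SF]. }
  set (B := fun y => / Derive F y).
  assert (SB : smooth (itv e) B).
  { apply smooth_inv; [apply itv_open | |].
    - intros y Hy; apply Rgt_not_eq, Pos, Het, Hy.
    - apply smooth_Derive, (smooth_incl (itv s)); [exact Hes | exact SF]. }
  assert (PosA : forall z, K z -> 0 < A z) by (intros z Hz; apply Pos, Het, HFg, Hz).
  assert (Dg : forall z, K z -> Derive g z = / A z).
  { intros z Hz; destruct (HFg z Hz) as [He1 _].
    assert (H : Derive (fun z => F (g z)) z = 1).
    { rewrite <- (Derive_id z); apply Derive_ext_loc.
      apply filter_imp with (2 := OK z Hz); intros w Hw; apply HFg, Hw. }
    rewrite (Derive_comp F g) in H.
    - fold (A z) in H; specialize (PosA z Hz).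
      apply (Rmult_eq_reg_r (A z)); [rewrite H; field|]; lra.
    - apply (smooth_ex_derive (itv s)); auto.
    - apply (smooth_ex_derive K); assumption. }
  set (phi := fun p : R * R => ((1 + fst p) * A (snd p) - 1, g (snd p)) : R * R).
  set (psi := fun p : R * R => ((1 + fst p) * B (snd p) - 1, F (snd p)) : R * R).
  assert (Sphi : forall z, K z -> forall x n,
            ex_diff_n (comp1 phi) n x z /\ ex_diff_n (comp2 phi) n x z).
  { intros z Hz x n; split.
    - apply (ex_diff_n_ext_loc (fun u v => (1 + 1 * u) * A v + (-1))).
      + apply locally_2d_forall; intros u v; unfold comp1, phi; simpl; ring.
      + apply (ex_diff_n_affine_mult K); assumption.
    - apply (ex_diff_n_ext_loc (fun u v => (1 + 0 * u) * g v + 0)).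
      + apply locally_2d_forall; intros u v; unfold comp2, phi; simpl; ring.
      + apply (ex_diff_n_affine_mult K); assumption. }
  assert (D1 : forall p, pdx (comp1 phi) p = A (snd p)).
  { intros p; unfold pdx, comp1, phi; simpl; apply is_derive_unique.
    auto_derive; [exact I | ring]. }
  assert (D2 : forall p, K (snd p) ->
            pdy (comp1 phi) p = (1 + fst p) * Derive A (snd p)).
  { intros p Hp; unfold pdy, comp1, phi; simpl; apply is_derive_unique.
    auto_derive; [apply (smooth_ex_derive K); assumption|].
    change (fun z => A z) with A; ring. }
  assert (D3 : forall p, pdx (comp2 phi) p = 0).
  { intros p; unfold pdx, comp2, phi; simpl; apply Derive_const. }
  assert (D4 : forall p, K (snd p) -> pdy (comp2 phi) p = / A (snd p)).
  { intros p Hp; unfold pdy, comp2, phi; simpl; apply Dg, Hp. }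
  exists phi; split; [split|].
  - unfold phi, origin, A; simpl; rewrite g0, DF0; f_equal; ring.
  - exists (fun p => -1 < fst p /\ K (snd p)),
           (fun p => -1 < fst p /\ itv e (snd p)), psi.
    split; [apply nbhd_half_strip; assumption|].
    split; [apply nbhd_half_strip; [apply itv_open | apply itv_0; lra]|].
    split; [intros p Hp n; apply Sphi, Hp|].
    split; [|split; [|split]].
    + intros [x y] [_ Hy] n; simpl in *; split.
      * apply (ex_diff_n_ext_loc (fun u v => (1 + 1 * u) * B v + (-1))).
        -- apply locally_2d_forall; intros u v; unfold comp1, psi; simpl; ring.
        -- apply (ex_diff_n_affine_mult (itv e)); [apply itv_open|..]; assumption.
      * apply (ex_diff_n_ext_loc (fun u v => (1 + 0 * u) * F v + 0)).
        -- apply locally_2d_forall; intros u v; unfold comp2, psi; simpl; ring.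
        -- apply (ex_diff_n_affine_mult (itv e)); [apply itv_open| |assumption].
           apply (smooth_incl (itv s)); [exact Hes | exact SF].
    + intros [x z] [Hx Hz]; simpl in *.
      destruct (HFg z Hz) as [Hgz EFg]; specialize (PosA z Hz).
      split; [split; [|exact Hgz]|].
      * assert (0 < (1 + x) * A z) by (apply Rmult_lt_0_compat; lra); lra.
      * unfold psi, phi, B; simpl; fold (A z); rewrite EFg; f_equal; field; lra.
    + intros [x y] [Hx Hy]; simpl in *.
      destruct (HgF y Hy) as [HK EgF].
      assert (P : 0 < Derive F y) by apply Pos, Het, Hy.
      assert (P' : 0 < B y) by apply Rinv_0_lt_compat, P.
      split; [split; [|exact HK]|].
      * assert (0 < (1 + x) * B y) by (apply Rmult_lt_0_compat; lra); lra.
      * unfold phi, psi, A, B; simpl; rewrite EgF; f_equal; field; lra.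
    + intros p [_ Hp]; unfold pullback, mu; rewrite D1, D2, D3, D4 by exact Hp.
      unfold phi; simpl; specialize (PosA _ Hp); f_equal; [ring | field; lra].
  - assert (N1 : locally origin (fun p => -1 < fst p /\ K (snd p))).
    { apply open_half_strip; [exact OK | split; [simpl; lra | exact K0]]. }
    assert (N2 : locally origin (fun p => itv r (fst (phi p)))).
    { assert (C := proj1 (Sphi 0 K0 0 0%nat)); destruct C as [C _].
      apply continuity_2d_pt_filterlim in C.
      assert (Z : comp1 phi 0 0 = 0).
      { unfold comp1, phi, A; simpl; rewrite g0, DF0; ring. }
      rewrite Z in C.
      assert (Hr : itv r 0) by (apply itv_0; lra).
      assert (N : locally origin (fun p => itv r (comp1 phi (fst p) (snd p)))).
      { exact (C (itv r) (itv_open r 0 Hr)). }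
      revert N; apply filter_imp; intros [x z]; trivial. }
    generalize (filter_and _ _ N1 N2); apply filter_imp.
    intros [x z] [[Hx Hz] Hr]; simpl in Hx, Hz.
    destruct (HFg z Hz) as [Hgz EFg].
    unfold tangent_map; rewrite D1, D2, D3, D4 by exact Hz.
    rewrite EY, (surjective_pairing (phi (x, z))), EX; [|exact Hr | apply Her, Hgz].
    unfold line_lift; simpl.
    assert (Eh : h z = A z * f (g z)).
    { unfold A; rewrite HF, EFg; [reflexivity | apply Hes, Hgz]. }
    assert (PA := PosA z Hz).
    (* The derivative of [F' * f = h o F], read at [g z]. *)
    assert (E2 : Derive (Derive F) (g z) * f (g z) + A z * Derive f (g z)
                 = A z * Derive h z).
    { assert (H : Derive (fun y => Derive F y * f y) (g z)
                  = Derive (fun y => h (F y)) (g z)).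
      { apply Derive_ext_loc.
        apply filter_imp with (2 := itv_open s _ (Hes _ Hgz)); exact HF. }
      rewrite Derive_mult, (Derive_comp h F), EFg in H.
      - exact H.
      - apply (smooth_ex_derive (fun _ => True)); trivial.
      - apply (smooth_ex_derive (itv s)); auto.
      - apply (smooth_ex_derive (itv s)); auto using smooth_Derive.
      - apply (smooth_ex_derive (itv r)); auto. }
    assert (DA : Derive A z = / A z * Derive (Derive F) (g z)).
    { unfold A at 1; rewrite (Derive_comp (Derive F) g).
      - rewrite (Dg z Hz); reflexivity.
      - apply (smooth_ex_derive (itv s)); auto using smooth_Derive.
      - apply (smooth_ex_derive K); assumption. }
    rewrite DA, Eh; f_equal; [|field; lra].
    transitivity ((1 + x) * (Derive (Derive F) (g z) * f (g z) - A z * Derive h z)).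
    + field; lra.
    + rewrite <- E2; ring.
Qed.

(** * Jets at the origin *)

Lemma Derive_n_zero n x : Derive_n (fun _ => 0) n x = 0.
Proof. destruct n; [reflexivity | apply Derive_n_const]. Qed.

Lemma partial_derive_zero m n x y : partial_derive m n (fun _ _ => 0) x y = 0.
Proof.
  unfold partial_derive; transitivity (Derive_n (fun _ => 0) m x);
    [|apply Derive_n_zero].
  apply Derive_n_ext; intros t; apply Derive_n_zero.
Qed.

Lemma Derive_n_Derive f n x : Derive_n (Derive f) n x = Derive_n f (S n) x.
Proof. pose proof (Derive_n_comp f n 1 x) as H; rewrite Nat.add_1_r in H; exact H. Qed.

Lemma line_lift_Derive_n X f r x n :
  0 < r ->
  (forall x y, itv r x -> itv r y -> X (x, y) = line_lift f (x, y)) ->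
  itv r x ->
  Derive_n (fun z => comp1 X x z) n 0 = - (1 + x) * Derive_n f (S n) 0 /\
  Derive_n (fun z => comp2 X x z) n 0 = Derive_n f n 0.
Proof.
  intros Hr EX Hx; rewrite <- Derive_n_Derive, <- Derive_n_scal_l.
  split; apply Derive_n_ext_loc;
    apply filter_imp with (2 := itv_open r 0 (itv_0 r Hr)); intros z Hz;
    unfold comp1, comp2; rewrite EX by assumption; reflexivity.
Qed.

(** The first component carries one more derivative of [f] than the second, hence
    the shift from [k] to [S k]. *)
Lemma line_lift_jets X f r k :
  0 < r ->
  (forall x y, itv r x -> itv r y -> X (x, y) = line_lift f (x, y)) ->
  (same_jet k X zero_field <-> forall j, (j <= S k)%nat -> Derive_n f j 0 = 0).
Proof.
  intros Hr EX; assert (Hr0 := itv_0 r Hr); split.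
  - intros HJ [|j] Hj.
    + destruct (HJ 0%nat 0%nat) as [_ H]; [lia|].
      unfold partial_derive, comp2, zero_field in H; simpl in H.
      rewrite EX in H by assumption; exact H.
    + destruct (HJ 0%nat j) as [H _]; [lia|].
      replace (partial_derive 0 j (comp1 zero_field) 0 0) with 0 in H
        by (symmetry; apply partial_derive_zero).
      change (Derive_n (fun z => comp1 X 0 z) j 0 = 0) in H.
      rewrite (proj1 (line_lift_Derive_n X f r 0 j Hr EX Hr0)) in H; lra.
  - intros HD m n Hmn.
    replace (partial_derive m n (comp1 zero_field) 0 0) with 0
      by (symmetry; apply partial_derive_zero).
    replace (partial_derive m n (comp2 zero_field) 0 0) with 0
      by (symmetry; apply partial_derive_zero).
    unfold partial_derive.
    split; (transitivity (Derive_n (fun _ => 0) m 0); [|apply Derive_n_zero]);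
      apply Derive_n_ext_loc;
      apply filter_imp with (2 := itv_open r 0 Hr0); intros x Hx;
      destruct (line_lift_Derive_n X f r x n Hr EX Hx) as [H1 H2].
    + rewrite H1, HD by lia; ring.
    + rewrite H2; apply HD; lia.
Qed.

Lemma smooth_power_sum a d k m :
  smooth (fun _ => True) (fun z => a * z ^ k + d * z ^ m).
Proof.
  assert (O : open (fun _ : R => True)) by apply open_true.
  apply smooth_plus; [exact O|..]; apply smooth_mult; try exact O;
    try (apply smooth_const, O); apply (smooth_pow _ O (fun z => z)), smooth_id, O.
Qed.

Lemma normal_form_line_lift k a d p :
  (1 <= k)%nat ->
  normal_form k a d p = line_lift (fun z => a * z ^ k + d * z ^ (2 * k - 1)) p.
Proof.
  intros Hk; destruct p as [x y]; unfold normal_form, line_lift; simpl fst; simpl snd.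
  assert (D : Derive (fun z => a * z ^ k + d * z ^ (2 * k - 1)) y
              = a * INR k * y ^ (k - 1) + d * (2 * INR k - 1) * y ^ (2 * k - 2)).
  { apply is_derive_unique; auto_derive; [exact I|].
    change (k + (k + 0))%nat with (2 * k)%nat.
    replace (pred k) with (k - 1)%nat by lia.
    replace (pred (2 * k - 1)) with (2 * k - 2)%nat by lia.
    rewrite (minus_INR (2 * k) 1), (mult_INR 2 k) by lia.
    change (INR 2) with 2; change (INR 1) with 1; ring. }
  rewrite D; reflexivity.
Qed.

Theorem theorem3p3 :
  forall X : vector_field, in_fields mu X ->
  (forall U : R * R -> Prop, nbhd U -> preserving_on U mu X ->
     forall p : R * R, U p -> ~ hyperbolic_singularity X p) /\
  (X origin <> (0, 0) ->
     exists a : R, a <> 0 /\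
       (conjugate mu X (normal_form_0 a) \/ conjugate mu X (normal_form_1 a))) /\
  (forall k : nat, (2 <= k)%nat ->
     (forall i : nat, (i <= k - 2)%nat -> same_jet i X zero_field) ->
     ~ same_jet (k - 1) X zero_field ->
     exists a d : R, a <> 0 /\ conjugate mu X (normal_form k a d)).
Proof.
  intros X HX.
  destruct (preserving_mu_line_lift X HX) as [r [f [Hr [Sf EX]]]].
  assert (Hr0 := itv_0 r Hr).
  assert (O : open (fun _ : R => True)) by apply open_true.
  split; [|split].
  - intros U HU HUX p Hp; exact (preserving_mu_not_hyperbolic U X p HU HUX Hp).
  - intros X0; unfold origin in X0; rewrite EX in X0 by assumption.
    destruct (Req_dec (f 0) 0) as [f0|f0].
    + assert (Df0 : Derive f 0 <> 0).
      { intros D; apply X0; unfold line_lift; simpl; rewrite f0, D; f_equal; ring. }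
      destruct (vanishing_order_factor r 1 f Hr Sf) as [u [Su [Ef Du]]].
      { intros j Hj; replace j with 0%nat by lia; exact f0. }
      simpl in Du; rewrite Rmult_1_l in Du.
      assert (u0 : u 0 <> 0) by (rewrite <- Du; exact Df0).
      destruct (line_conjugate_linear r f u Hr Su u0) as [s [F [Hs HF]]].
      { intros y Hy; rewrite Ef by exact Hy; ring. }
      exists (u 0); split; [exact u0|]; right.
      apply (line_lift_conjugate X _ f (fun z => u 0 * z) r s F); auto.
      * apply smooth_mult; [exact O | apply smooth_const, O | apply smooth_id, O].
      * intros [x y]; unfold normal_form_1, line_lift; simpl; f_equal.
        rewrite Derive_scal, Derive_id; ring.
    + destruct (line_conjugate_const r f Hr Sf f0) as [s [F [Hs HF]]].
      exists (f 0); split; [exact f0|]; left.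
      apply (line_lift_conjugate X _ f (fun _ => f 0) r s F); auto.
      * apply smooth_const, O.
      * intros [x y]; unfold normal_form_0, line_lift; simpl; f_equal.
        rewrite Derive_const; ring.
  - intros k Hk Hlow Hhigh.
    assert (V : forall j, (j < k)%nat -> Derive_n f j 0 = 0).
    { intros j Hj; apply (proj1 (line_lift_jets X f r (k - 2) Hr EX)); [|lia].
      apply Hlow; lia. }
    destruct (vanishing_order_factor r k f Hr Sf V) as [u [Su [Ef Du]]].
    assert (u0 : u 0 <> 0).
    { intros u0; apply Hhigh, (line_lift_jets X f r (k - 1) Hr EX).
      intros j Hj; destruct (Nat.eq_dec j k) as [->|N]; [|apply V; lia].
      rewrite Du, u0; ring. }
    destruct (line_conjugate_power r k f u Hk Hr Su u0 Ef) as [d [s [F [Hs HF]]]].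
    exists (u 0), d; split; [exact u0|].
    apply (line_lift_conjugate X _ f (fun z => u 0 * z ^ k + d * z ^ (2 * k - 1)) r s F);
      auto using smooth_power_sum.
    intros p; apply normal_form_line_lift; lia.
Qed.
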